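(* Let $L_1:=L_1(1,\infty)$ and let $A$ be the bounded operator on $L_1$ given by $(Au)(s)=u(s)/s$. Let $g$ be a Stieltjes function with representation $(0,0,\mu)$ and $g(0+)=\infty$. Assume that for some $\alpha\in(0,1)$ the function $\tau\mapsto\tau^\alpha g(\tau)$ is increasing on $(0,1)$. Let $\epsilon$ be a slowly varying function on $(g(1),\infty)$. Then the function $$y(s):=-\frac{g'(1/s)}{s^2g^2(1/s)\,\epsilon(g(1/s))},\qquad s>1,$$ is positive, belongs to $L_1$, and satisfies $$N_t(y)=O\left(\frac{1}{g(1/t)\,\epsilon(g(1/t))}\right),\qquad t\to\infty.$$ Moreover, $y\in\mathrm{dom}(g(A))$ if and only if $$\int_{g(1)}^\infty\frac{d\tau}{\tau\,\epsilon(\tau)}<\infty.$$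
   Context: A Stieltjes function with representation $(0,0,\mu)$ is a function $g(z)=\int_{(0,\infty)}\frac{\mu(ds)}{z+s}$, $z>0$, where $\mu$ is a positive Radon measure on $(0,\infty)$ with $\int_{(0,\infty)}\frac{\mu(ds)}{1+s}<\infty$. Here $g(0+)=\lim_{s\to0+}g(s)$. A measurable function $\epsilon:(a,\infty)\to(0,\infty)$, $a\ge0$, is slowly varying (at infinity) if $\lim_{t\to+\infty}\epsilon(\lambda t)/\epsilon(t)=1$ for all $\lambda>0$. For $u\in L_1$ and $t\ge1$: $N_t(u):=\frac1t\int_1^t s|u(s)|\,ds+\int_t^\infty|u(s)|\,ds$. The operator $g(A)$ (defined by the extended Hille–Phillips functional calculus for the generator $-A$ of the semigroup $(T(t)u)(s)=e^{-t/s}u(s)$ on $L_1$) is the multiplication operator $(g(A)u)(s)=g(1/s)u(s)$ with domain $\mathrm{dom}(g(A))=\{u\in L_1:\int_1^\infty g(1/s)|u(s)|\,ds<\infty\}$.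
   Formalization: The formal theorem also assumes that 1/ε is integrable on (g(1),b] for every finite b>g(1); without this y need not belong to L_1 (e.g. ε(τ)=min(τ−g(1),1)), and the condition is necessary for y∈L_1. *)

(* Defs.v *)
From HB Require Import structures.
From mathcomp Require Import all_boot all_order all_algebra.
From mathcomp Require Import all_classical all_reals all_analysis.

Set Implicit Arguments.
Unset Strict Implicit.
Unset Printing Implicit Defensive.

Import Order.TTheory GRing.Theory Num.Theory.
Import numFieldNormedType.Exports.
Local Open Scope classical_set_scope.
Local Open Scope ring_scope.

(* Needed to write f =O_+oo h. *)
Canonical pinfty_nbhs_filter_on (R : realType) :=
  FilterType (pinfty_nbhs R) (@filter_filter _ _ (@proper_pinfty_nbhs R)).

(* Measures on (0,oo) are given as Borel measures on the line, of which only
   the restriction to (0,oo) is ever used. *)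
Definition radon_pos (R : realType)
    (mu : {measure set (measurableTypeR R) -> \bar R}) : Prop :=
  forall K : set R, compact K -> K `<=` `]0, +oo[ -> (mu K < +oo)%E.

(* The values of g outside (0,oo) are irrelevant. *)
Definition stieltjes_rep00 (R : realType)
    (mu : {measure set (measurableTypeR R) -> \bar R}) (g : R -> R) : Prop :=
  [/\ radon_pos mu,
      (\int[mu]_(s in `]0%R, +oo[) ((1 + s)^-1)%:E < +oo)%E
    & forall z : R, 0 < z ->
        ((g z)%:E = \int[mu]_(s in `]0%R, +oo[) ((z + s)^-1)%:E)%E].

Definition slowly_varying (R : realType) (a : R) (eps : R -> R) : Prop :=
  [/\ 0 <= a,
      measurable_fun `]a, +oo[ eps,
      (forall t, a < t -> 0 < eps t)
    & forall lambda : R, 0 < lambda ->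
        eps (lambda * t) / eps t @[t --> +oo] --> (1 : R)].

(* 1/eps is integrable on every (a,b] with b finite. Slow variation gives this
   only far out: it says nothing of how small eps can be on bounded sets. *)
Definition inv_loc_integrable (R : realType) (a : R) (eps : R -> R) : Prop :=
  forall b : R, a < b ->
    (@lebesgue_measure R).-integrable `]a, b] (fun t => ((eps t)^-1)%:E).

(* Representatives of the elements of L_1(1,oo). *)
Definition L1 (R : realType) : set (R -> R) :=
  [set u | (@lebesgue_measure R).-integrable `]1, +oo[ (EFin \o u)].

(* These Rintegrals are the usual integrals for u in L1 and 1 <= t. *)
Definition Nt (R : realType) (u : R -> R) (t : R) : R :=
  t^-1 * (\int[lebesgue_measure]_(s in `]1, t[) (s * `|u s|))
  + \int[lebesgue_measure]_(s in `]t, +oo[) `|u s|.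

(* For A the multiplication by 1/s on L_1(1,oo), the operator g(A) is the
   multiplication by g(1/s) with its maximal domain. *)
Definition dom_gA (R : realType) (g : R -> R) : set (R -> R) :=
  [set u | L1 u /\
     (\int[lebesgue_measure]_(s in `]1%R, +oo[) (g s^-1 * `|u s|)%:E < +oo)%E].

Definition yfun (R : realType) (g eps : R -> R) (s : R) : R :=
  - (derive1 g s^-1 / (s ^+ 2 * (g s^-1) ^+ 2 * eps (g s^-1))).

(* Main.v *)
(* Put h(s) = g(1/s), an increasing C^1 map of (0,oo) with h -> oo at oo.  Then
   y = h' / (h^2 eps(h)), so the change of variables tau = h(s) turns the
   integrals of y and of g(1/s) y into those of 1/(tau^2 eps(tau)) and of
   1/(tau eps(tau)).  The substitution must hold for merely measurable
   integrands, so it is obtained by identifying the image under h of the measure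
   h'(s) ds with Lebesgue measure.  In N_t(y), the tail integral becomes the tail
   of 1/(tau^2 eps(tau)).  The monotonicity of tau^alpha g(tau) gives
   s <= t (h(s)/h(t))^(1/alpha) for s <= t, which bounds the other term by
   h(t)^(-1/alpha) times the integral of tau^(1/alpha-2)/eps(tau) up to h(t).
   Both are O(1/(h(t) eps(h(t)))) by Karamata's estimates, which follow from
   Potter's bounds, hence from the uniform convergence theorem for slowly
   varying functions. *)

Require Import Defs.
From HB Require Import structures.
From mathcomp Require Import all_boot all_order all_algebra.
From mathcomp Require Import all_classical all_reals all_analysis.
From mathcomp Require Import measurable_realfun.
Import Order.TTheory GRing.Theory Num.Theory.
Import numFieldNormedType.Exports HBNNSimple.
Local Open Scope classical_set_scope.
Local Open Scope ring_scope.
Set Implicit Arguments.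
Unset Strict Implicit.
Unset Printing Implicit Defensive.

(** * Change of variables *)

(** The measure [nu] with density [w] integrates only over [B] intersected with [D], so the sign of
    [w] outside [D] does not matter. The formula holds for indicators by definition of [nu], for
    simple functions by linearity, and for [f] by monotone convergence along [nnsfun_approx] on both
    sides. *)
Lemma ge0_integral_density d (T : measurableType d) (R : realType)
    (mu : {measure set T -> \bar R}) (D : set T) (w : T -> R) :
  measurable D -> measurable_fun D w -> (forall x, D x -> 0 <= w x) ->
  exists nu : {measure set T -> \bar R},
    (forall B, measurable B -> nu B = \int[mu]_(x in B `&` D) (w x)%:E)%E /\
    forall f : T -> \bar R, measurable_fun D f ->
      (forall x, D x -> 0 <= f x)%E ->
      (\int[nu]_(x in D) f x = \int[mu]_(x in D) (f x * (w x)%:E))%E.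
Proof.
move=> mD mw w0; have mwE : measurable_fun D (EFin \o w) by exact/measurable_EFinP.
pose nu (B : set T) := (\int[mu]_(x in B `&` D) (w x)%:E)%E.
have nu0 : nu set0 = 0%E by rewrite /nu set0I integral_set0.
have nu_ge0 B : (0 <= nu B)%E by apply: integral_ge0 => x [_ /w0]; rewrite lee_fin.
have nu_sa : semi_sigma_additive nu.
  move=> F mF tF mUF; rewrite /nu setI_bigcupl.
  rewrite ge0_integral_bigcup //=.
  - apply: is_cvg_nneseries => n _ _.
    by apply: integral_ge0 => x [_ /w0]; rewrite lee_fin.
  - by move=> k; exact: measurableI.
  - by apply: measurable_funS mwE => // x [k _ [_]].
  - by move=> x [k _ [_ /w0]]; rewrite lee_fin.
  - exact: trivIset_setIr.
pose nuM : {measure set T -> \bar R} :=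
  HB.pack nu (@isMeasure.Build _ T R nu nu0 nu_ge0 nu_sa).
have nuME B : nuM B = nu B by [].
clearbody nuM; exists nuM; split => // f mf f0.
have nuI (k : R) (A : set T) : measurable A -> (0 <= k)%R ->
    (\int[mu]_(x in D) ((k * \1_A x)%:E * (w x)%:E) = k%:E * nuM (A `&` D))%E.
  move=> mA k0; under eq_integral do rewrite EFinM -muleA.
  rewrite ge0_integralZl_EFin//; last 2 first.
  - by move=> x Dx; rewrite mule_ge0 ?lee_fin ?w0//.
  - by apply: emeasurable_funM => //; apply/measurable_EFinP.
  congr (_ * _)%E; rewrite nuME /nu -setIA setIid setIC integral_mkcondr.
  apply: eq_integral => x xD; rewrite patchE indicE.
  by case: (x \in A); rewrite ?mul1e ?mul0e.
pose f_ := nnsfun_approx mD mf.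
transitivity (limn (fun n => \int[nuM]_(x in D) (f_ n x)%:E)%E).
  rewrite -monotone_convergence//.
  - apply: eq_integral => y /[!inE] yD; apply/esym/cvg_lim => //.
    by apply: cvg_nnsfun_approx.
  - by move=> n; exact/measurable_EFinP/measurable_funTS.
  - by move=> n y _; rewrite lee_fin.
  - by move=> y _ m n mn; rewrite lee_fin; exact/lefP/nd_nnsfun_approx.
transitivity (limn (fun n => \int[mu]_(x in D) ((f_ n x)%:E * (w x)%:E))%E); last first.
  rewrite -monotone_convergence//.
  - apply: eq_integral => y /[!inE] yD; apply/cvg_lim => //.
    by apply: cvgeZr => //; apply: cvg_nnsfun_approx.
  - move=> n; apply: emeasurable_funM => //.
    by apply/measurable_EFinP/measurable_funTS.
  - by move=> n y /w0 wy; apply: mule_ge0; rewrite lee_fin.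
  - move=> y Dy m n mn; rewrite lee_pmul ?lee_fin ?w0//.
    exact/lefP/nd_nnsfun_approx.
congr (limn _); apply/funext => n.
transitivity (\sum_(k \in range (f_ n))
    \int[nuM]_(x in D) (k * \1_(f_ n @^-1` [set k]) x)%:E)%E.
  under eq_integral do rewrite fimfunE -fsumEFin//.
  rewrite ge0_integral_fsum//.
  - by move=> y; exact/measurable_EFinP/measurable_funM.
  - by move=> y x _; rewrite nnfun_muleindic_ge0.
transitivity (\sum_(k \in range (f_ n))
    \int[mu]_(x in D) ((k * \1_(f_ n @^-1` [set k]) x)%:E * (w x)%:E))%E.
  apply: eq_fsbigr => r; rewrite inE /= => -[x _ fxr].
  have r0 : (0 <= r)%R by rewrite -fxr.
  by rewrite integralZl_indic_nnsfun// integral_indic// nuI.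
rewrite -ge0_integral_fsum//.
- apply: eq_integral => x xD.
  rewrite fimfunE -fsumEFin// ge0_mule_fsuml//.
  by move=> i; rewrite nnfun_muleindic_ge0.
- move=> r; apply: emeasurable_funM => //.
  by apply/measurable_EFinP/measurable_funM.
- move=> r x Dx; rewrite mule_ge0 ?lee_fin ?w0// -lee_fin nnfun_muleindic_ge0//.
Qed.

Lemma is_derive_gt0_homo (R : realType) (c : R) (h dh : R -> R) :
  (forall s, c < s -> is_derive s 1 h (dh s)) ->
  (forall s, c < s -> 0 < dh s) ->
  forall x y, c < x -> x < y -> h x < h y.
Proof.
move=> hdh dh0 x y cx xy.
have ch : {within `[x, y], continuous h}.
  apply: derivable_within_continuous => z; rewrite in_itv/= => /andP[xz _].
  by have [] := hdh z (lt_le_trans cx xz).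
have [|z] := @MVT _ h dh _ _ xy _ ch.
  by move=> z; rewrite in_itv/= => /andP[xz _]; exact/hdh/(lt_trans cx xz).
rewrite in_itv/= => /andP[xz _] E.
by rewrite -subr_gt0 E mulr_gt0 ?subr_gt0//; exact/dh0/(lt_trans cx xz).
Qed.

(** Two Borel measures on the line that agree on half-open intervals coincide. It thus suffices to
    compute the image of [dh s ds] on intervals, where the fundamental theorem of calculus gives
    their length; no continuity of [F] is involved. The margin [c < a] makes [h] differentiable at
    the endpoint [a] too. *)
Lemma ge0_change_of_variables (R : realType) (c a : R) (h dh F : R -> R) :
  c < a ->
  (forall s, c < s -> is_derive s 1 h (dh s)) ->
  (forall s, c < s -> {for s, continuous dh}) ->
  (forall s, c < s -> 0 < dh s) ->
  h s @[s --> +oo] --> +oo ->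
  measurable_fun `]h a, +oo[ F ->
  (forall x, h a < x -> 0 <= F x) ->
  (\int[lebesgue_measure]_(x in `]h a, +oo[) (F x)%:E =
   \int[lebesgue_measure]_(s in `]a, +oo[) (F (h s) * dh s)%:E)%E.
Proof.
move=> ca hdh cdh dh0 hoo mF F0.
pose lam : {measure set (measurableTypeR R) -> \bar R} := @lebesgue_measure R.
have hlt := is_derive_gt0_homo hdh dh0.
have hle x y : c < x -> x <= y -> h x <= h y.
  by move=> cx; rewrite le_eqVlt => /predU1P[->//|xy]; exact/ltW/hlt.
have hltE x y : c < x -> c < y -> (h x < h y) = (x < y).
  move=> cx cy; case: (ltP x y) => [xy|yx]; first by rewrite hlt.
  by apply/negbTE; rewrite -leNgt hle.
have hleE x y : c < x -> c < y -> (h x <= h y) = (x <= y).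
  by move=> cx cy; rewrite !leNgt hltE.
have ch s : c < s -> {for s, continuous h}.
  move=> cs; have [dfh _] := hdh s cs.
  by apply: differentiable_continuous; exact/derivable1_diffP.
have surj y : h a < y -> exists2 s, a < s & h s = y.
  move=> hay.
  have [b [ab yb]] : exists b, a < b /\ y <= h b.
    near (pinfty_nbhs R) => b; exists b; split; near: b.
      by apply: nbhs_pinfty_gt; rewrite num_real.
    by move/cvgryPge : hoo => /(_ y).
  have chab : {within `[a, b], continuous h}.
    apply: continuous_in_subspaceT => z; rewrite inE/= in_itv/= => /andP[az _].
    exact/ch/(lt_le_trans ca az).
  have hab : h a <= h b by rewrite (le_trans _ yb)// ltW.
  have [|s] := IVT (ltW ab) chab (v := y).
    by rewrite min_l// max_r// (ltW hay).
  rewrite in_itv/= => /andP[as_ sb] hs; exists s => //.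
  by rewrite lt_neqAle as_ andbT; apply: contraTneq hay => ->; rewrite hs ltxx.
pose D : set R := `]a, +oo[%classic.
have Da s : D s -> a < s by rewrite /D/= in_itv/= andbT.
have mD : measurable D by exact: measurable_itv.
have mh : measurable_fun D h.
  apply: open_continuous_measurable_fun; first exact: interval_open.
  by move=> s; rewrite inE => /Da /(lt_trans ca) /ch.
have mdh : measurable_fun D dh.
  apply: open_continuous_measurable_fun; first exact: interval_open.
  by move=> s; rewrite inE => /Da /(lt_trans ca) /cdh.
have [nu [nuE nuint]] := @ge0_integral_density
  _ (measurableTypeR R) R lebesgue_measure D dh
  mD mdh (fun s Ds => ltW (dh0 s (lt_trans ca (Da s Ds)))).
(* Freezing [h] at the value [h a] to the left of [a] gives a map measurable on the whole line, as
   an image measure requires. Since [nu] is carried by [D], where [phi] is [h], nothing else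
   changes. *)
pose phi : measurableTypeR R -> measurableTypeR R := fun s => h (Num.max s a).
have mphi : measurable_fun setT phi.
  apply: (@measurable_comp _ _ _ _ _ _ `]c, +oo[%classic h).
  - exact: measurable_itv.
  - by move=> _ [s _ <-] /=; rewrite in_itv/= andbT lt_max ca orbT.
  - apply: open_continuous_measurable_fun; first exact: interval_open.
    by move=> s; rewrite inE/= in_itv/= andbT => /ch.
  - exact: measurable_maxr.
have phiE s : D s -> phi s = h s by move=> /Da as_; rewrite /phi max_l// ltW.
pose phim : {mfun _ >-> _} := HB.pack phi (isMeasurableFun.Build _ _ _ _ _ mphi).

have ftc r t : a <= r -> r < t ->
    (\int[lam]_(s in `]r, t]) (dh s)%:E = (h t)%:E - (h r)%:E)%E.
  move=> ar rt; have cr := lt_le_trans ca ar.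
  rewrite integral_itv_obnd_cbnd; last first.
    apply/measurable_EFinP; apply: measurable_funS mdh => //.
    by move=> z; rewrite /D/= !in_itv/= andbT => /andP[/(le_lt_trans ar)].
  apply: continuous_FTC2 => //.
  - apply: continuous_in_subspaceT => z; rewrite inE/= in_itv/= => /andP[rz _].
    exact/cdh/(lt_le_trans cr rz).
  - split.
    + move=> z; rewrite in_itv/= => /andP[rz _].
      by have [] := hdh z (lt_trans cr rz).
    + by apply: cvg_at_right_filter; exact: ch.
    + by apply: cvg_at_left_filter; exact: (ch _ (lt_trans cr rt)).
  - move=> z; rewrite in_itv/= => /andP[rz _].
    by rewrite derive1E; have [] := hdh z (lt_trans cr rz).
have nuphi B : measurable B ->
    nu (phi @^-1` B) = (\int[lam]_(s in D `&` h @^-1` B) (dh s)%:E)%E.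
  move=> mB; rewrite nuE; last first.
    by rewrite -[X in measurable X]setTI; exact (mphi measurableT B mB).
  congr integral; apply/seteqP; split => [s [] /[swap] Ds|s [Ds]] /=.
    by rewrite phiE.
  by rewrite phiE.
pose D' : set R := `]h a, +oo[%classic.
have mD' : measurable D' by exact: measurable_itv.
have mcD' : measurable (~` D') by exact: measurableC.
(* The image of [nu] lives on [D'] only; adding Lebesgue measure on the complement of [D'] completes
   it to a candidate for Lebesgue measure on the line. *)
have lamE A : measurable A ->
    lam A = measure_add (pushforward nu phim) (mrestr lam mcD') A.
  apply: lebesgue_measure_unique => _ [[x y] _ <-].
  rewrite [RHS](measure_addE (pushforward nu phim) (mrestr lam mcD')
    `]x, y]%classic) /= /mrestr /pushforward.
  rewrite [X in (X + _)%E](nuphi `]x, y]%classic); last exact: measurable_itv.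
  rewrite lebesgue_measure_itv/= lte_fin; case: ltP => [xy|yx]; last first.
    rewrite set_itv_ge ?bnd_simp -?leNgt// preimage_set0 setI0 set0I.
    by rewrite integral_set0 measure0 adde0.
  (* A nonempty []x, y]] lies to the left of [h a], to its right, or straddles it. In the last case
     the two summands measure []h a, y]] and []x, h a]]. *)
  have [yha|hay] := leP y (h a).
    rewrite (_ : _ `&` _ = set0) ?integral_set0 ?add0e; last first.
      rewrite -subset0 => s [Ds] /=; rewrite in_itv/= => /andP[_ hsy].
      have := hlt _ _ ca (Da _ Ds); rewrite ltNge (le_trans hsy)//.
    rewrite setIidl ?lebesgue_measure_itv/= ?lte_fin ?xy// => z /=.
    rewrite /D'/= !in_itv/= andbT => /andP[_ zy].
    by apply/negP; rewrite -leNgt (le_trans zy).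
  have [t at_ hty] := surj _ hay.
  have [hax|xha] := leP (h a) x.
    have [r ar hrx] : exists2 r, a <= r & h r = x.
      move: hax; rewrite le_eqVlt => /predU1P[<-|/surj[r ar <-]]; first by exists a.
      by exists r => //; exact: ltW.
    have cr := lt_le_trans ca ar; have ct := lt_trans ca at_.
    have rt : r < t by rewrite -hltE// hrx hty.
    rewrite (_ : D `&` _ = `]r, t]%classic).
      rewrite ftc// hrx hty (_ : _ `&` _ = set0) ?measure0 ?adde0//.
      rewrite -subset0 => z [] /=; rewrite /D'/= !in_itv/= andbT => /andP[xz _]; apply.
      exact: le_lt_trans xz.
    apply/seteqP; split => s /=; rewrite /D/= !in_itv/= andbT.
      move=> [as_ /andP[]]; have cs := lt_trans ca as_.
      by rewrite -hrx -hty hltE// hleE// => -> ->.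
    move=> /andP[rs st]; have as_ := le_lt_trans ar rs; have cs := lt_trans ca as_.
    by rewrite as_; split => //; rewrite -hrx -hty hltE// hleE// rs.
  have ct := lt_trans ca at_.
  rewrite (_ : D `&` _ = `]a, t]%classic).
    rewrite ftc// (_ : _ `&` _ = `]x, (h a)]%classic).
      rewrite lebesgue_measure_itv/= lte_fin xha hty.
      by rewrite -!EFinB -EFinD addrA subrK.
    apply/seteqP; split => z /=; rewrite /D'/= !in_itv/= andbT.
      by move=> [/andP[-> _] /negP]; rewrite -leNgt.
    move=> /andP[-> zha]; split; first by rewrite (le_trans zha)// ltW.
    by apply/negP; rewrite -leNgt.
  apply/seteqP; split => s /=; rewrite /D/= !in_itv/= andbT.
    move=> [as_ /andP[_]]; have cs := lt_trans ca as_.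
    by rewrite -hty hleE// as_.
  move=> /andP[as_ st]; have cs := lt_trans ca as_.
  rewrite as_; split => //; rewrite (lt_trans xha) ?hltE//=.
  by rewrite -hty hleE.
have mEF : measurable_fun D' (EFin \o F) by exact/measurable_EFinP.
transitivity (\int[pushforward nu phim]_(x in D') (F x)%:E)%E.
  apply: eq_measure_integral => A mA AD'.
  have := lamE mphi A mA.
  rewrite [in X in X -> _](measure_addE (pushforward nu phim) (mrestr lam mcD')).
  rewrite /= /mrestr (_ : A `&` _ = set0) ?measure0 ?adde0//.
  by rewrite -subset0 => z [/AD'].
rewrite (@ge0_integral_pushforward _ _ _ _ _ phim)//; last first.
  by move=> y; rewrite inE /D'/= in_itv/= andbT lee_fin; exact: F0.
have -> : phim @^-1` D' = D.
  apply/seteqP; split => s; rewrite /D/D'/= /phi !in_itv/= !andbT.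
    by rewrite hltE// ?lt_max ?ltxx ?ca ?orbT ?orbF.
  by move=> as_; rewrite max_l ?ltW// hlt.
rewrite nuint; last 2 first.
- apply/measurable_EFinP; apply: (@measurable_comp _ _ _ _ _ _ D') => //.
  + move=> _ [s /Da as_ <-] /=; rewrite /D'/= in_itv/= andbT /phi max_l ?ltW//.
    exact: hlt.
  + exact: measurable_funTS mphi.
- move=> s /Da as_ /=; rewrite lee_fin F0// /phi max_l ?ltW// hlt//.
apply: eq_integral => s /[!inE] Ds.
by rewrite -EFinM /= -/(phi s) phiE.
Unshelve. all: end_near. Qed.

(** Apply the unbounded version to [F] cut off outside []h a, h b]]; as [h] is strictly increasing,
    composing the cut-off with [h] gives the cut-off outside []a, b]]. *)
Lemma ge0_change_of_variables_bnd (R : realType) (c a b : R) (h dh F : R -> R) :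
  c < a -> a <= b ->
  (forall s, c < s -> is_derive s 1 h (dh s)) ->
  (forall s, c < s -> {for s, continuous dh}) ->
  (forall s, c < s -> 0 < dh s) ->
  h s @[s --> +oo] --> +oo ->
  measurable_fun `]h a, +oo[ F ->
  (forall x, h a < x -> 0 <= F x) ->
  (\int[lebesgue_measure]_(x in `]h a, h b]) (F x)%:E =
   \int[lebesgue_measure]_(s in `]a, b]) (F (h s) * dh s)%:E)%E.
Proof.
move=> ca ab hdh cdh dh0 hoo mF F0.
have hlt := is_derive_gt0_homo hdh dh0.
pose P : set R := `]h a, h b]%classic.
have PE : `]h a, +oo[%classic `&` P = P.
  apply/setIidPr => x; rewrite /P/= !in_itv/= andbT => /andP[-> _] //.
rewrite -/P -PE integral_mkcondr.
have mFP : measurable_fun `]h a, +oo[ (F \_ P).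
  apply/(measurable_restrict _ (measurable_itv _) (measurable_itv _)).
  rewrite PE; apply: measurable_funS mF; first exact: measurable_itv.
  by rewrite -PE; exact: subIsetl.
transitivity (\int[lebesgue_measure]_(x in `]h a, +oo[) ((F \_ P) x)%:E)%E.
  by apply: eq_integral => x _; rewrite !patchE; case: ifP.
rewrite (@ge0_change_of_variables _ c a h dh (F \_ P))//; last first.
  by move=> x hx; rewrite patchE; case: ifP => // _; exact: F0.
have -> : `]a, b]%classic = `]a, +oo[%classic `&` (`]a, b]%classic : set R).
  by apply/esym/setIidPr => x; rewrite /= !in_itv/= andbT => /andP[-> _].
rewrite [RHS]integral_mkcondr; apply: eq_integral => s.
rewrite inE/= in_itv/= andbT => as_; rewrite !patchE.
have -> : (h s \in P) = (s \in (`]a, b]%classic : set R)).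
  apply/idP/idP; rewrite !inE /P/= !in_itv/= as_ /=.
    move=> /andP[_ hsb]; rewrite leNgt; apply/negP => bs.
    by have := hlt _ _ (lt_le_trans ca ab) bs; rewrite ltNge hsb.
  rewrite (hlt _ _ ca as_) /= le_eqVlt => /predU1P[->|sb]; first exact: lexx.
  by apply/ltW/hlt => //; exact: lt_trans as_.
by case: ifP; rewrite ?mul0r.
Qed.

(** * Slowly varying functions *)

Lemma lebesgue_measure_preimage_subr (R : realType) (u : R) (A : set R) :
  measurable A ->
  lebesgue_measure ((fun x => x - u) @^-1` A) = lebesgue_measure A.
Proof.
move=> mA.
pose f : measurableTypeR R -> measurableTypeR R := fun x => x - u.
have mf : measurable_fun setT f by exact: measurable_funB.
pose fm : {mfun _ >-> _} := HB.pack f (isMeasurableFun.Build _ _ _ _ _ mf).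
apply/esym; transitivity (pushforward lebesgue_measure fm A) => //.
apply: lebesgue_measure_unique => // _ [[a b] _ <-].
rewrite /= /pushforward.
have -> : fm @^-1` `]a, b] = `](a + u), (b + u)]%classic.
  by apply/seteqP; split => x /=; rewrite /f !in_itv/= ltrBrDr lerBlDr.
rewrite !lebesgue_measure_itv/= !lte_fin ltrD2r; case: ifP => // _.
by rewrite -!EFinB opprD addrACA subrr addr0.
Qed.

(** As [z n] tends to infinity, the functions [k (z n + l) - k (z n)] of [l] tend to 0 pointwise on
    [[0, 2]], and Egorov's theorem makes this uniform off a small set. The length 2 leaves room for
    [l] in [[1, 2]] together with its shift [l - u], [u] in [[0, 1]]. *)
Lemma Egorov_translations (R : realType) (k : R -> R) (z : nat -> R)
    (e d : R) : 0 < e -> 0 < d ->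
  measurable_fun setT k ->
  (forall u, k (x + u) - k x @[x --> +oo] --> 0) ->
  (forall n, n%:R <= z n) ->
  exists2 B : set R, measurable B /\ (lebesgue_measure B < d%:E)%E &
    \forall n \near \oo, forall l, 0 <= l <= 2 -> ~ B l ->
      `|k (z n + l) - k (z n)| < e.
Proof.
move=> e0 d0 mk hk nz.
have zoo : z n @[n --> \oo] --> +oo.
  apply/cvgryPge => A; near=> n; apply: le_trans (nz n); near: n.
  exact: nbhs_infty_ger.
pose f n l := k (z n + l) - k (z n).
have mf n : measurable_fun `[0, 2 : R] (f n).
  apply: measurable_funB => //; apply: measurable_funTS.
  by apply: measurableT_comp => //; exact: measurable_funD.
have fin02 : (lebesgue_measure (`[0%R, 2%R]%classic : set R) < +oo)%E.
  by rewrite lebesgue_measure_itv/= lte_fin ltr0n/= -EFinB ltry.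
have f0 : {ae lebesgue_measure, forall l : measurableTypeR R,
    `[0, 2 : R]%classic l -> f n l @[n --> \oo] --> (cst 0 : R -> R) l}.
  by apply: aeW => l _; exact: (cvg_comp _ _ zoo (hk l)).
have m0 : measurable_fun `[0, 2 : R] (cst 0 : R -> R) by exact: measurable_cst.
have [B [mB Bd unif]] := ae_pointwise_almost_uniform (mu := @lebesgue_measure R) mf m0
  (measurable_itv _) fin02 f0 d0.
exists B => //.
have : nbhs (cst 0 : {uniform` (`[0, 2]%classic `\` B) -> R})
    [set g | forall l, 0 <= l <= 2 -> ~ B l -> `|g l| < e].
  apply/uniform_nbhs; exists [set xy | ball xy.1 e xy.2]; split.
    exact: (entourage_ball _ (PosNum e0)).
  move=> g /= gB l l02 nBl; have := gB l.
  rewrite in_itv/= -[X in X -> _]/(_ /\ _ -> _) /ball/= sub0r normrN; apply.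
  by split.
by move/unif.
Unshelve. all: end_near. Qed.

(* If the bound fails at z n and u = u n, put w n = z n + u.  Off two sets of
   measure < 1/4, k varies little along the translates of z n and of w n, so some
   l in [1, 2] is good for both z n + l and w n + (l - u), the same point. *)
Lemma uniform_convergence_translations (R : realType) (k : R -> R) (e : R) :
  0 < e ->
  measurable_fun setT k ->
  (forall u, k (x + u) - k x @[x --> +oo] --> 0) ->
  exists X, forall x u, X <= x -> 0 <= u <= 1 -> `|k (x + u) - k x| <= e.
Proof.
move=> e0 mk hk; apply: contrapT => /forallNP noX.
have /choice[p hp] (n : nat) : exists p : R * R,
    [/\ n%:R <= p.1, 0 <= p.2 <= 1 & e < `|k (p.1 + p.2) - k p.1|].
  have /existsNP[x /existsNP[u /not_implyP[nx /not_implyP[u01 /negP]]]] := noX n%:R.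
  by rewrite -ltNge => h; exists (x, u).
pose z n := (p n).1; pose w n := (p n).1 + (p n).2.
have zn n : n%:R <= z n by have [] := hp n.
have wn n : n%:R <= w n.
  by have [+ /andP[+ _] _] := hp n => h1 h2; rewrite /w (le_trans h1)// lerDl.
have e20 : 0 < e / 2 by rewrite divr_gt0.
have d0 : 0 < 4^-1 :> R by rewrite invr_gt0.
have [B1 [mB1 B1d] hB1] := Egorov_translations e20 d0 mk hk zn.
have [B2 [mB2 B2d] hB2] := Egorov_translations e20 d0 mk hk wn.
near \oo => n.
have h1 : forall l, 0 <= l <= 2 -> ~ B1 l -> `|k (z n + l) - k (z n)| < e / 2.
  by near: n.
have h2 : forall l, 0 <= l <= 2 -> ~ B2 l -> `|k (w n + l) - k (w n)| < e / 2.
  by near: n.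
have [_ /andP[u0 u1] big] := hp n; set u := (p n).2 in u0 u1.
pose B2u := (fun x => x - u) @^-1` B2.
have mB2u : measurable B2u.
  have mshift : measurable_fun setT (fun x : R => x - u).
    exact: measurable_funB.
  by rewrite -[B2u]setTI; exact: (mshift measurableT B2 mB2).
have B2ud : (lebesgue_measure B2u < (4^-1)%:E)%E.
  by rewrite lebesgue_measure_preimage_subr.
(* A point [l] outside both sets would give [|k (w n) - k (z n)| < e / 2 + e / 2] through the common
   point [z n + l], against [big]. *)
have cover : `[1, 2 : R] `<=` B1 `|` B2u.
  move=> l; rewrite /= in_itv/= => /andP[l1 l2].
  apply: contrapT => /not_orP[nB1 nB2].
  have l0 : 0 <= l <= 2 by rewrite l2 (le_trans _ l1).
  have lu0 : 0 <= l - u <= 2.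
    by rewrite subr_ge0 (le_trans u1)// lerBlDr (le_trans l2)// lerDl.
  have lt_e := ltrD (h1 l l0 nB1) (h2 (l - u) lu0 nB2).
  rewrite (_ : w n + (l - u) = z n + l) -?splitr in lt_e; last first.
    by rewrite /w addrACA subrr addr0.
  have := ler_distD (k (z n + l)) (k (w n)) (k (z n)).
  rewrite [leRHS]addrC (distrC (k (w n)) (k (z n + l))) => dist.
  by have := lt_trans (lt_le_trans big dist) lt_e; rewrite ltxx.
(* The interval has measure 1, while the two sets covering it have total measure below 1/2. *)
have : (lebesgue_measure (`[1%R, 2%R]%classic : set R) <=
    lebesgue_measure B1 + lebesgue_measure B2u)%E.
  apply: (le_trans _ (measureU2 (@lebesgue_measure R) mB1 mB2u)).
  by apply: le_measure => //; rewrite inE//; exact: measurableU.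
apply/negP; rewrite -ltNge (lt_trans (lteD B1d B2ud))//.
rewrite lebesgue_measure_itv/= lte_fin ltr1n/= -EFinB -EFinD lte_fin.
rewrite (_ : 2 - 1 = 1)//; last by apply/eqP; rewrite subr_eq.
rewrite (_ : 4 = 2 * 2); last by rewrite -natrM.
rewrite -mulr2n -[_ *+ 2]mulr_natr invfM -mulrA mulVf ?mulr1// invf_lt1//.
by rewrite ltr1n.
Unshelve. all: end_near. Qed.

(** Walk from [x] to [x + u] in [truncn u] unit steps and one fractional step, each costing at most
    [e]. With [k] the logarithm of a slowly varying function of [exp x], this linear growth becomes
    a power bound. *)
Lemma abs_le_of_unit_steps (R : realType) (k : R -> R) (e X : R) :
  (forall x u, X <= x -> 0 <= u <= 1 -> `|k (x + u) - k x| <= e) ->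
  forall x u, X <= x -> 0 <= u -> `|k (x + u) - k x| <= e * (u + 1).
Proof.
move=> hk x u Xx u0.
have e0 : 0 <= e by apply: le_trans (hk X 0 _ _) => //; rewrite lexx ler01.
have step n : `|k (x + n%:R) - k x| <= e * n%:R.
  elim: n => [|n IH]; first by rewrite addr0 subrr normr0 mulr0.
  rewrite -natr1 addrA mulrDr mulr1 [leRHS]addrC.
  apply: le_trans (ler_distD (k (x + n%:R)) _ _) _; rewrite lerD//.
  by rewrite hk ?ler01 ?lexx// (le_trans Xx)// lerDl.
pose n := Num.truncn u.
have /andP[nu un] := truncn_itv u0.
apply: le_trans (ler_distD (k (x + n%:R)) _ _) _.
rewrite mulrDr mulr1 [leRHS]addrC lerD//; last by rewrite (le_trans (step n))// ler_wpM2l.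
rewrite -(subrK n%:R u) (addrC (u - _)) addrA hk//.
  by rewrite (le_trans Xx)// lerDl.
by rewrite subr_ge0 nu/= lerBlDl natr1 ltW.
Qed.

Lemma cvgry_expR (R : realType) : @expR R x @[x --> +oo] --> +oo.
Proof.
apply/cvgryPge => A; near=> x; apply: le_trans (expR_ge1Dx x).
have Ax : A <= x by near: x; apply: nbhs_pinfty_ge; rewrite num_real.
by rewrite (le_trans Ax)// lerDr.
Unshelve. all: end_near. Qed.

(** In logarithmic coordinates, [k x = ln (eps (exp x))], slow variation says that [k (x + u) - k x]
    tends to 0. Uniform convergence with tolerance [d], followed by unit steps, bounds
    [|k (ln T) - k (ln S)|] by [d * (ln (T / S) + 1)]; exponentiating gives both inequalities. *)
Lemma slowly_varying_potter (R : realType) (a : R) (eps : R -> R) (d : R) :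
  slowly_varying a eps -> 0 < d ->
  exists T0 C : R, [/\ a < T0, 0 < C &
    forall S T, T0 <= S -> S <= T ->
      eps S <= C * (T / S) `^ d * eps T /\ eps T <= C * (T / S) `^ d * eps S].
Proof.
move=> [a0 meps eps0 sv] d0.
pose E : set R := expR @^-1` `]a, +oo[%classic.
have EE x : E x = (a < expR x) :> Prop by rewrite /E/= in_itv/= andbT.
have mE : measurable E.
  by rewrite -[E]setTI; exact: (measurable_expR measurableT (measurable_itv _)).
(* Outside [E] nothing is known about [eps]; a default value there makes [k] measurable on the whole
   line and leaves it unchanged near infinity. *)
pose k := (@ln R \o (eps \o expR)) \_ E.
have kE x : a < expR x -> k x = ln (eps (expR x)).
  by move=> ax; rewrite /k patchE mem_set// EE.
have mk : measurable_fun setT k.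
  apply/(measurable_restrictT _ _).1 => //.
  apply: measurableT_comp => //.
  apply: (@measurable_comp _ _ _ _ _ _ `]a, +oo[%classic) => //.
  - by move=> _ [x + <-]; rewrite EE /= in_itv/= andbT; exact.
  - apply: measurable_funTS; exact: measurable_expR.
have Eoo : \forall x \near +oo, a < expR x.
  by move/cvgryPgt : (@cvgry_expR R) => /(_ a).
have hk u : k (x + u) - k x @[x --> +oo] --> 0.
  have : ln (eps (expR u * expR x) / eps (expR x)) @[x --> +oo] --> 0.
    have sv1 : eps (expR u * expR x) / eps (expR x) @[x --> +oo] --> (1 : R).
      exact: (cvg_comp _ _ (@cvgry_expR R) (sv _ (expR_gt0 u))).
    rewrite -(@ln1 R).
    exact: (cvg_comp _ _ sv1 (@continuous_ln R 1 ltr01)).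
  apply: cvg_trans; apply: near_eq_cvg; near=> x.
  have ax : a < expR x by near: x.
  have axu : a < expR (x + u).
    near: x; move/cvgryPgt : (@cvgry_expR R) => /(_ a) [M [Mr hM]].
    by exists (M - u); split; rewrite ?num_real// => y; rewrite ltrBlDr => /hM.
  by rewrite !kE// -expRD addrC ln_div// posrE eps0.
have [X hX] := uniform_convergence_translations d0 mk hk.
have {}hX := abs_le_of_unit_steps hX.
(* The term [a + 1] puts the threshold strictly above [a], and [expR X] ensures [X <= ln S]. The
   constant [expR d] comes from the [+ 1] in the unit-step bound. *)
exists (Num.max (a + 1) (expR X)), (expR d); split.
- by rewrite lt_max ltrDl ltr01.
- exact: expR_gt0.
move=> S T; rewrite ge_max => /andP[aS XS] ST.
have aS' : a < S by apply: lt_le_trans aS; rewrite ltrDl.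
have S0 : 0 < S by exact: le_lt_trans aS'.
have T0 : 0 < T by exact: lt_le_trans ST.
have aT : a < T by exact: lt_le_trans ST.
have lnST : 0 <= ln T - ln S by rewrite subr_ge0 ler_ln.
have := hX (ln S) (ln T - ln S) _ lnST.
rewrite (addrC (ln S)) subrK !kE ?lnK ?posrE//.
rewrite -[X in X <= _]expRK ler_ln ?posrE ?expR_gt0// => /(_ XS).
rewrite /powR gt_eqF ?divr_gt0// ln_div ?posrE//.
have epsS := eps0 _ aS'; have epsT := eps0 _ aT.
rewrite ler_norml => /andP[h1 h2]; split.
- rewrite -{1}(lnK epsS) -{1}(lnK epsT) -!expRD ler_expR.
  by rewrite -lerBlDr -opprB lerNl (le_trans _ h1)// (mulrDr d _ 1) mulr1 (addrC d).
- rewrite -{1}(lnK epsT) -{1}(lnK epsS) -!expRD ler_expR.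
  by rewrite -lerBlDr (le_trans h2)// (mulrDr d _ 1) mulr1 (addrC d).
Unshelve. all: end_near. Qed.

(** * Karamata's estimates *)

Lemma cvg_invr_at_right0 (R : realType) : x^-1 @[x --> +oo] --> (0 : R)^'+.
Proof.
move=> A [e /= e0 eA]; suff : \forall x \near +oo, A x^-1 by [].
near=> x; have x0 : 0 < x by near: x; apply: nbhs_pinfty_gt; rewrite num_real.
apply: eA; last by rewrite invr_gt0.
rewrite /ball/= sub0r normrN gtr0_norm ?invr_gt0// invf_plt ?posrE//.
by near: x; apply: nbhs_pinfty_gt; rewrite num_real.
Unshelve. all: end_near. Qed.

Lemma is_derive_powR_div (R : realType) (p x : R) : p != 0 -> 0 < x ->
  is_derive x 1 (fun t => t `^ p / p) (x `^ (p - 1)).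
Proof.
move=> p0 x0; have h := is_derive1_powR p x0.
rewrite (_ : (fun t => _) = p^-1 *: (@powR R ^~ p)); last first.
  by apply/funext => t /=; rewrite mulrC.
apply: is_derive_eq.
by rewrite scalerA mulVf// scale1r.
Qed.

Lemma continuous_powRl (R : realType) (p x : R) : 0 < x ->
  {for x, continuous (fun t => t `^ p)}.
Proof.
move=> x0; have [dp _] := is_derive1_powR p x0.
by apply: differentiable_continuous; exact/derivable1_diffP.
Qed.

Lemma integral_powR_tail (R : realType) (p T : R) : 0 < p -> 0 < T ->
  (\int[lebesgue_measure]_(x in `]T, +oo[) (x `^ (- p - 1))%:E =
   (T `^ (- p) / p)%:E)%E.
Proof.
move=> p0 T0.
have mpow : measurable_fun `]T, +oo[ (fun x : R => x `^ (- p - 1)).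
  by apply: measurable_funTS; exact: measurable_powR.
rewrite integral_itv_obnd_cbnd; last exact/measurable_EFinP.
have dF x : T < x -> is_derive x 1 (fun t => t `^ (- p) / - p) (x `^ (- p - 1)).
  by move=> Tx; apply: is_derive_powR_div; rewrite ?oppr_eq0 ?gt_eqF// (lt_trans T0).
rewrite (@ge0_continuous_FTC2y _ _ (fun t => t `^ (- p) / - p) _ 0).
- by rewrite sub0e -EFinN invrN mulrN opprK.
- by move=> x _; exact: powR_ge0.
- apply: continuous_in_subspaceT => x; rewrite inE/= in_itv/= andbT => Tx.
  by apply: continuous_powRl; rewrite (lt_le_trans T0).
- rewrite -(mul0r (- p)^-1); apply: cvgMl.
  apply: cvg_trans (cvg_comp _ _ (@cvg_invr_at_right0 R) (powR_cvg0 p0)).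
  apply: near_eq_cvg; near=> x.
  have x0 : 0 < x by near: x; apply: nbhs_pinfty_gt; rewrite num_real.
  by rewrite /= -[x^-1]powR_inv1 ?ltW// -powRrM mulN1r.
- by move=> x /dF[].
- apply: cvg_at_right_filter.
  by apply: cvgMl; exact: continuous_powRl.
- by move=> x; rewrite in_itv/= andbT derive1E => /dF[].
Unshelve. all: end_near. Qed.

Lemma integral_powR_le (R : realType) (p S T : R) : 0 < p -> 0 < S -> S <= T ->
  (\int[lebesgue_measure]_(x in `]S, T]) (x `^ (p - 1))%:E <= (T `^ p / p)%:E)%E.
Proof.
move=> p0 S0; rewrite le_eqVlt => /predU1P[->|ST].
  by rewrite set_itv_ge ?bnd_simp ?ltxx// integral_set0 lee_fin divr_ge0 ?powR_ge0// ltW.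
have mpow : measurable_fun `]S, T] (fun x : R => x `^ (p - 1)).
  by apply: measurable_funTS; exact: measurable_powR.
rewrite integral_itv_obnd_cbnd; last exact/measurable_EFinP.
have dF x : S < x -> is_derive x 1 (fun t => t `^ p / p) (x `^ (p - 1)).
  by move=> Sx; apply: is_derive_powR_div; rewrite ?gt_eqF// (lt_trans S0).
rewrite (@continuous_FTC2 _ _ (fun t => t `^ p / p) _ _ ST).
- by rewrite -EFinB lee_fin gerBl divr_ge0 ?powR_ge0// ltW.
- apply: continuous_in_subspaceT => x; rewrite inE/= in_itv/= => /andP[Sx _].
  by apply: continuous_powRl; rewrite (lt_le_trans S0).
- split.
  + by move=> x; rewrite in_itv/= => /andP[/dF[]].
  + by apply: cvg_at_right_filter; apply: cvgMl; exact: continuous_powRl.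
  + apply: cvg_at_left_filter; apply: cvgMl; apply: continuous_powRl.
    exact: lt_trans ST.
- by move=> x; rewrite in_itv/= derive1E => /andP[/dF[]].
Qed.

(** The common form of the estimates below: [f] is dominated by a multiple of a simpler [g], whose
    integral is known through an upper bound only. *)
Lemma ge0_le_integral_scale d (T : measurableType d) (R : realType)
    (mu : {measure set T -> \bar R}) (D : set T) (f g : T -> R) (c I : R) :
  measurable D -> measurable_fun D f -> measurable_fun D g -> 0 <= c ->
  (forall x, D x -> 0 <= g x) ->
  (forall x, D x -> 0 <= f x <= c * g x) ->
  (\int[mu]_(x in D) (g x)%:E <= I%:E)%E ->
  (\int[mu]_(x in D) (f x)%:E <= (c * I)%:E)%E.
Proof.
move=> mD mf mg c0 g0 fcg gI.
have mfE : measurable_fun D (EFin \o f) by exact/measurable_EFinP.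
have mgE : measurable_fun D (EFin \o g) by exact/measurable_EFinP.
apply: (@le_trans _ _ (\int[mu]_(x in D) (c%:E * (g x)%:E))%E).
  apply: ge0_le_integral => //.
  - by move=> x /fcg/andP[]; rewrite lee_fin.
  - by apply: measurable_funeM.
  - by move=> x /fcg/andP[_]; rewrite -EFinM lee_fin.
rewrite ge0_integralZl_EFin//.
by rewrite EFinM lee_wpmul2l// lee_fin.
Qed.

(* Proves equalities of products and quotients up to associativity and
   commutativity. *)
Ltac mul_ac := rewrite ?invfM ?invrK -?mulrA; repeat first
  [ reflexivity
  | match goal with |- @eq _ (@GRing.mul _ ?x _) (@GRing.mul _ ?x _) =>
      apply: (congr1 (fun t => x * t)) end
  | match goal with |- @eq _ (@GRing.mul _ ?x _) _ =>
      first [rewrite [in RHS](mulrCA _ x) | rewrite [in RHS](mulrC _ x)] end ].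

Lemma measurable_inv_sqr_mul (R : realType) (a : R) (eps : R -> R) :
  slowly_varying a eps ->
  measurable_fun `]a, +oo[ (fun x => (x ^+ 2 * eps x)^-1).
Proof.
move=> [a0 meps eps0 _].
have mx : measurable_fun `]a, +oo[ (fun x => x ^+ 2 * eps x).
  by apply: measurable_funM => //; exact: measurable_funX.
apply: (@measurable_comp _ _ _ _ _ _ (`]0, +oo[%classic : set R)
  (fun y : R => y^-1)) => //.
- move=> _ [x + <-]; rewrite /= !in_itv/= !andbT => ax.
  by rewrite mulr_gt0 ?eps0// exprn_gt0// (le_lt_trans a0).
- apply: open_continuous_measurable_fun; first exact: interval_open.
  by move=> x; rewrite inE/= in_itv/= andbT => x0; apply: inv_continuous; rewrite gt_eqF.
Qed.

(** Potter's bound with exponent 1/2 gives [1 / eps x <= C * (x / T) ^ (1/2) / eps T] for [x > T].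
    The integrand is then at most a multiple of [x ^ (- 3/2)], whose tail integral [2 * T ^ (- 1/2)]
    supplies the factor [1 / 2^-1]. *)
Lemma karamata_tail (R : realType) (a : R) (eps : R -> R) :
  slowly_varying a eps ->
  exists T0 C : R, [/\ a < T0, 0 < C & forall T, T0 <= T ->
    (\int[lebesgue_measure]_(x in `]T, +oo[) ((x ^+ 2 * eps x)^-1)%:E
       <= (C / (T * eps T))%:E)%E].
Proof.
move=> sv; have d0 : 0 < 2^-1 :> R by rewrite invr_gt0.
have half2 : 2^-1 + 2^-1 = 1 :> R by rewrite [RHS]splitr !mul1r.
have [T0 [C [aT0 C0 potter]]] := slowly_varying_potter sv d0.
have minv := measurable_inv_sqr_mul sv.
case: sv => a0 meps eps0 _.
exists T0, (C / 2^-1); split => //; first by rewrite divr_gt0.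
move=> T T0T; have aT := lt_le_trans aT0 T0T.
have Tgt0 : 0 < T by exact: le_lt_trans aT.
have epsT := eps0 _ aT.
have -> : C / 2^-1 / (T * eps T) =
    C * T `^ (- 2^-1) / eps T * (T `^ (- 2^-1) / 2^-1).
  have TT : T `^ (- 2^-1) * T `^ (- 2^-1) = T^-1.
    rewrite -powRD; last by rewrite (gt_eqF Tgt0) implybT.
    rewrite -opprD half2.
    by rewrite powR_inv1// ltW.
  by rewrite invfM -TT; mul_ac.
have potT x : T < x -> eps T <= C * (x / T) `^ 2^-1 * eps x.
  by move=> Tx; exact: (potter T x T0T (ltW Tx)).1.
apply: (@ge0_le_integral_scale _ (measurableTypeR R) R (@lebesgue_measure R) _ _
  (fun x : R => x `^ (- 2^-1 - 1))) => //.
- apply: measurable_funS minv => // x /=; rewrite !in_itv/= !andbT.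
  exact: lt_trans.
- by apply: measurable_funTS; exact: measurable_powR.
- by rewrite mulr_ge0 ?invr_ge0 ?ltW// mulr_gt0// powR_gt0.
- by move=> x _; exact: powR_ge0.
- move=> x; rewrite /= in_itv/= andbT => Tx; have ax := lt_trans aT Tx.
  have x0 := lt_trans Tgt0 Tx; have epsx := eps0 _ ax.
  apply/andP; split; first by rewrite invr_ge0 mulr_ge0 ?exprn_ge0 ?ltW.
  rewrite -[leLHS]mul1r ler_pdivrMr; last by rewrite mulr_gt0// exprn_gt0.
  have xx : x `^ (- 2^-1 - 1) * x ^+ 2 = x `^ 2^-1.
    rewrite -powR_mulrn ?ltW// -powRD; last by rewrite (gt_eqF x0) implybT.
    congr (_ `^ _); apply: (addrI 2^-1).
    rewrite half2 -addrA addNKr addrC; apply/eqP; rewrite subr_eq.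
    by rewrite -(natrD _ 1 1).
  rewrite (_ : _ * (_ * _) = C * (x / T) `^ 2^-1 * eps x / eps T).
    by rewrite ler_pdivlMr// mul1r potT.
  have TV : T^-1 `^ 2^-1 = T `^ (- 2^-1).
    by rewrite -[T^-1]powR_inv1 ?ltW// -powRrM mulN1r.
  by rewrite powRM ?invr_ge0 ?ltW// TV -xx; mul_ac.
- by rewrite integral_powR_tail.
Qed.

Lemma ge0_integral_itv_split (R : realType) (f : R -> R) (a c : R)
    (b : itv_bound R) :
  a <= c -> (BRight c <= b)%O ->
  measurable_fun [set` Interval (BRight a) b] f ->
  (forall x, a < x -> 0 <= f x) ->
  (\int[lebesgue_measure]_(x in [set` Interval (BRight a) b]) (f x)%:E =
   \int[lebesgue_measure]_(x in `]a, c]) (f x)%:E +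
   \int[lebesgue_measure]_(x in [set` Interval (BRight c) b]) (f x)%:E)%E.
Proof.
move=> ac cb mf f0.
have E := @itv_bndbnd_setU _ _ (BRight a) (BRight c) b ac cb.
rewrite E ge0_integral_setU//.
- by rewrite -E; exact/measurable_EFinP.
- move=> x; rewrite -E /= in_itv/= => /andP[ax _].
  by rewrite lee_fin f0.
- apply/disj_set2P; rewrite -subset0 => x [] /=; rewrite !in_itv/=.
  by move=> /andP[_ xc] /andP[]; rewrite ltNge xc.
Qed.

Lemma integral_head_lty (R : realType) (a b : R) (eps : R -> R) :
  inv_loc_integrable a eps -> (forall x, a < x -> 0 < eps x) -> a < b ->
  exists2 K : R, 0 <= K &
    (\int[lebesgue_measure]_(x in `]a, b]) ((eps x)^-1)%:E <= K%:E)%E.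
Proof.
move=> loc eps0 ab; have /integrableP[mie] := loc b ab.
rewrite (_ : (\int[_]_(x in _) _)%E =
  \int[lebesgue_measure]_(x in `]a, b]) ((eps x)^-1)%:E)%E; last first.
  apply: eq_integral => x; rewrite inE/= in_itv/= => /andP[ax _].
  by rewrite ger0_norm// invr_ge0 ltW// eps0.
move=> foo; have I0 : (0 <= \int[lebesgue_measure]_(x in `]a, b]) ((eps x)^-1)%:E)%E.
  apply: integral_ge0 => x; rewrite /= in_itv/= => /andP[ax _].
  by rewrite lee_fin invr_ge0 ltW// eps0.
exists (fine (\int[lebesgue_measure]_(x in `]a, b]) ((eps x)^-1)%:E)%E).
  exact: fine_ge0.
by rewrite fineK// ge0_fin_numE.
Qed.

(** Karamata's estimate controls the tail beyond [T0]; on []a, T0]] the factor [x ^ (- 2)] is at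
    most [a ^ (- 2)] and [1 / eps] is integrable. *)
Lemma integral_inv_sqr_mul_lty (R : realType) (a : R) (eps : R -> R) :
  0 < a -> slowly_varying a eps -> inv_loc_integrable a eps ->
  (\int[lebesgue_measure]_(x in `]a, +oo[) ((x ^+ 2 * eps x)^-1)%:E < +oo)%E.
Proof.
move=> a0 sv loc; have minv := measurable_inv_sqr_mul sv.
have [T0 [C [aT0 C0 tail]]] := karamata_tail sv.
case: sv => _ meps eps0 _.
have [K K0 headK] := integral_head_lty loc eps0 aT0.
have /integrableP[/measurable_EFinP mie _] := loc _ aT0.
rewrite (@ge0_integral_itv_split _ _ _ T0) ?(ltW aT0)//; last first.
  by move=> x ax; rewrite invr_ge0 mulr_ge0 ?exprn_ge0 ?ltW ?eps0// (lt_trans a0).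
rewrite lte_add_pinfty//; last by rewrite (le_lt_trans (tail _ (lexx _))) ?ltry.
apply: le_lt_trans (ltry ((a ^+ 2)^-1 * K)).
apply: (@ge0_le_integral_scale _ (measurableTypeR R) R (@lebesgue_measure R) _ _
  (fun x : R => (eps x)^-1)) => //.
- apply: measurable_funS minv => // x /=; rewrite !in_itv/= !andbT.
  by case/andP.
- by rewrite invr_ge0 exprn_ge0// ltW.
- by move=> x; rewrite /= in_itv/= => /andP[ax _]; rewrite invr_ge0 ltW// eps0.
- move=> x; rewrite /= in_itv/= => /andP[ax _]; have epsx := eps0 _ ax.
  have x0 := lt_trans a0 ax.
  apply/andP; split; first by rewrite invr_ge0 mulr_ge0 ?exprn_ge0 ?ltW.
  rewrite invfM ler_wpM2r ?invr_ge0 ?(ltW epsx)//.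
  by rewrite lef_pV2 ?posrE ?exprn_gt0// lerXn2r ?nnegrE ?ltW.
Qed.

(** Beyond [T0], Potter's bound replaces [1 / eps x] by [C * (T / x) ^ p / eps T], which leaves an
    integrable power of [x]. The part up to [T0] is a constant, absorbed because
    [T ^ r / (T * eps T)] stays away from 0 for [T >= T0]. *)
Lemma karamata_head (R : realType) (a : R) (eps : R -> R) (r : R) :
  0 < a -> slowly_varying a eps -> inv_loc_integrable a eps -> 1 < r ->
  exists T0 C : R, [/\ a < T0, 0 < C & forall T, T0 <= T ->
    (\int[lebesgue_measure]_(x in `]a, T]) (x `^ r * (x ^+ 2 * eps x)^-1)%:E
       <= (C * (T `^ r / (T * eps T)))%:E)%E].
Proof.
move=> a0 sv loc r1; have minv := measurable_inv_sqr_mul sv.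
(* Then [x ^ r / x ^ 2 = x ^ (2 p - 1)], and after losing [p] to Potter's bound the exponent [p - 1]
   still exceeds -1. *)
pose p := (r - 1) / 2.
have r0 : 0 <= r by rewrite (le_trans ler01)// ltW.
have p0 : 0 < p by rewrite divr_gt0// subr_gt0.
have rE : r = p + p + 1 by rewrite -splitr subrK.
clearbody p.
have powr x : 0 < x -> x `^ r = x `^ p * x `^ p * x.
  move=> x0; rewrite rE powRD; last by rewrite (gt_eqF x0) implybT.
  rewrite powRr1 ?ltW// powRD//.
  by rewrite (gt_eqF x0) implybT.
have [T0 [C [aT0 C0 potter]]] := slowly_varying_potter sv p0.
case: sv => _ meps eps0 _.
have [K K0 headK] := integral_head_lty loc eps0 aT0.
have /integrableP[/measurable_EFinP mie _] := loc _ aT0.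
have T00 := lt_trans a0 aT0; have epsT0 := eps0 _ aT0.
(* By Potter's bound between [T0] and [T], [1 / M] is a lower bound of
   [T ^ r / (T * eps T) = T ^ (2 p) / eps T]. *)
pose M := C * eps T0 / (T0 `^ p * T0 `^ p).
have M0 : 0 < M by rewrite divr_gt0 ?mulr_gt0 ?powR_gt0.
(* This bounds the integral over []a, T0]], where [x ^ r <= T0 ^ r] and [x ^ (- 2) <= a ^ (- 2)]. *)
pose K' := T0 `^ r / a ^+ 2 * K.
have K'0 : 0 <= K' by rewrite mulr_ge0// divr_ge0 ?powR_ge0// exprn_ge0// ltW.
exists T0, (K' * M + C / p); split => //.
  by apply: ltr_wpDl; [rewrite mulr_ge0// ltW|rewrite divr_gt0].
move=> T T0T; have aT := lt_le_trans aT0 T0T; have Tgt0 := lt_trans a0 aT.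
have epsT := eps0 _ aT.
have mf : measurable_fun `]a, +oo[ (fun x => x `^ r * (x ^+ 2 * eps x)^-1).
  apply: measurable_funM => //.
  by apply: measurable_funTS; exact: measurable_powR.
have f0 x : a < x -> 0 <= x `^ r * (x ^+ 2 * eps x)^-1.
  move=> ax; rewrite mulr_ge0 ?powR_ge0// invr_ge0 mulr_ge0 ?exprn_ge0 ?ltW ?eps0//.
  exact: lt_trans ax.
rewrite (@ge0_integral_itv_split _ _ _ T0) ?(ltW aT0)//; last first.
  by apply: measurable_funS mf => // x /=; rewrite !in_itv/= andbT => /andP[].
rewrite mulrDl EFinD leeD//.
- apply: (@le_trans _ _ K'%:E).
    apply: (@ge0_le_integral_scale _ (measurableTypeR R) R (@lebesgue_measure R) _ _
      (fun x : R => (eps x)^-1)) => //.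
    + apply: measurable_funS mf => // x /=; rewrite !in_itv/= !andbT.
      by case/andP.
    + by rewrite divr_ge0 ?powR_ge0// exprn_ge0// ltW.
    + by move=> x; rewrite /= in_itv/= => /andP[ax _]; rewrite invr_ge0 ltW// eps0.
    + move=> x; rewrite /= in_itv/= => /andP[ax xT0]; have epsx := eps0 _ ax.
      have x0 := lt_trans a0 ax.
      apply/andP; split; first exact: f0.
      rewrite invfM mulrA ler_wpM2r ?invr_ge0 ?(ltW epsx)//.
      rewrite ler_pM ?powR_ge0 ?invr_ge0 ?exprn_ge0 ?(ltW x0)//.
        by rewrite ge0_ler_powR// ?nnegrE ltW.
      by rewrite lef_pV2 ?posrE ?exprn_gt0// lerXn2r ?nnegrE ?ltW.
  rewrite lee_fin -mulrA ler_peMr// mulrA ler_pdivlMr ?mulr_gt0// mul1r.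
  have := (potter T0 T (lexx _) T0T).2.
  rewrite powRM ?invr_ge0 ?(ltW Tgt0) ?(ltW T00)// => h.
  rewrite (@le_trans _ _ (T * (C * (T `^ p * T0^-1 `^ p) * eps T0)))//.
    by rewrite ler_pM2l.
  rewrite powr// /M.
  have -> : T0^-1 `^ p = T0 `^ p / (T0 `^ p * T0 `^ p).
    rewrite invfM mulrA mulfV ?mul1r ?gt_eqF ?powR_gt0//.
    by rewrite -powRN -powR_inv1 ?(ltW T00)// -powRrM mulN1r.
  have -> : T * (C * (T `^ p * (T0 `^ p / (T0 `^ p * T0 `^ p))) * eps T0) =
    (C * eps T0 * T / (T0 `^ p * T0 `^ p)) * T `^ p * T0 `^ p by mul_ac.
  have -> : C * eps T0 / (T0 `^ p * T0 `^ p) * (T `^ p * T `^ p * T) =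
    (C * eps T0 * T / (T0 `^ p * T0 `^ p)) * T `^ p * T `^ p by mul_ac.
  rewrite ler_pM2l.
    by rewrite ge0_ler_powR ?nnegrE ?(ltW p0) ?(ltW T00) ?(ltW Tgt0).
  by rewrite mulr_gt0 ?divr_gt0 ?mulr_gt0 ?powR_gt0.
- have -> : C / p * (T `^ r / (T * eps T)) = C * T `^ p / eps T * (T `^ p / p).
    rewrite powr// -!mulrA; rewrite invfM.
    have -> : T * (T^-1 / eps T) = (eps T)^-1 by rewrite mulrA mulfV ?mul1r// gt_eqF.
    by mul_ac.
  apply: (@ge0_le_integral_scale _ (measurableTypeR R) R (@lebesgue_measure R) _ _
    (fun x : R => x `^ (p - 1))) => //.
  + apply: measurable_funS mf => // x /=; rewrite !in_itv/= !andbT.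
    by case/andP => /(lt_trans aT0).
  + by apply: measurable_funTS; exact: measurable_powR.
  + by rewrite mulr_ge0 ?invr_ge0 ?ltW// mulr_gt0// powR_gt0.
  + by move=> x _; exact: powR_ge0.
  + move=> x; rewrite /= in_itv/= => /andP[T0x xT].
    have ax := lt_trans aT0 T0x; have epsx := eps0 _ ax; have x0 := lt_trans a0 ax.
    apply/andP; split; first exact: f0.
    rewrite ler_pdivrMr ?mulr_gt0 ?exprn_gt0//.
    have h : x `^ p * eps T <= C * T `^ p * eps x.
      have := (potter x T (ltW T0x) xT).2.
      rewrite -(ler_pM2l (powR_gt0 p x0)) => /le_trans; apply.
      rewrite powRM ?invr_ge0 ?(ltW Tgt0) ?(ltW x0)//.
      have xV : x `^ p * x^-1 `^ p = 1.
        by rewrite -powRM ?invr_ge0 ?(ltW x0)// mulfV ?powR1// gt_eqF.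
      rewrite -[leRHS]mul1r -xV le_eqVlt; apply/orP; left; apply/eqP; mul_ac.
    have -> : C * T `^ p / eps T * x `^ (p - 1) * (x ^+ 2 * eps x) =
        C * T `^ p * eps x / eps T * (x `^ p * x).
      by rewrite -(mulr_powRB1 (ltW x0) p0) expr2; mul_ac.
    rewrite powr// -mulrA ler_pM2r ?mulr_gt0 ?powR_gt0//.
    by rewrite ler_pdivlMr.
  + exact: integral_powR_le.
Qed.

(** * Stieltjes functions *)

Lemma stieltjes_kernel_measurable (R : realType) (z : R) (n : nat) : 0 < z ->
  measurable_fun (`]0, +oo[%classic : set R) (fun s : R => (z + s) ^- n).
Proof.
move=> z0; apply: open_continuous_measurable_fun; first exact: interval_open.
move=> s; rewrite inE/= in_itv/= andbT => s0.
have zs0 : z + s != 0 by rewrite gt_eqF ?addr_gt0.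
apply: (@continuous_comp _ _ _ (fun s : R => (z + s) ^+ n) (fun y : R => y^-1)).
  apply: (@continuous_comp _ _ _ (fun s : R => z + s) (fun y : R => y ^+ n)).
    by apply: cvgD; [exact: cvg_cst|exact: cvg_id].
  exact: exprn_continuous.
by apply: inv_continuous; rewrite expf_neq0.
Qed.

(** One factor obeys [1 + s <= (1 + 1 / u) * (z + s)], the others [u <= z + s]. The majorant is
    uniform in [z >= u] and a multiple of [1 / (1 + s)], as needed for dominated convergence. *)
Lemma stieltjes_kernel_le (R : realType) (u z s : R) (n : nat) :
  0 < u -> u <= z -> 0 < s ->
  0 <= (z + s) ^- n.+1 <= u ^- n * (1 + u^-1) * (1 + s)^-1.
Proof.
move=> u0 uz s0; have z0 := lt_le_trans u0 uz.
have zs0 : 0 < z + s by rewrite addr_gt0.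
have us0 : 0 < u + s by rewrite addr_gt0.
have s10 : 0 < 1 + s by rewrite addr_gt0.
apply/andP; split; first by rewrite invr_ge0 exprn_ge0 ?(ltW zs0).
rewrite exprSr invfM -mulrA ler_pM ?invr_ge0 ?exprn_ge0 ?(ltW zs0)//.
  rewrite lef_pV2 ?posrE ?exprn_gt0// lerXn2r ?nnegrE ?(ltW u0) ?(ltW zs0)//.
  by rewrite (le_trans uz)// lerDl ltW.
rewrite ler_pdivlMr// mulrC ler_pdivrMr// mulrDl mul1r.
apply: (@le_trans _ _ (1 + (u + s))).
  by rewrite lerD2l lerDr ltW.
rewrite addrC lerD//; first by rewrite lerD2r.
by rewrite ler_pdivlMl// mulr1 (le_trans uz)// lerDl ltW.
Qed.

Section stieltjes.
Context (R : realType) (mu : {measure set (measurableTypeR R) -> \bar R})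
  (g : R -> R) (gmu : stieltjes_rep00 mu g).

Let B : set (measurableTypeR R) := `]0, +oo[%classic.

Let mB : measurable B. Proof. exact: measurable_itv. Qed.

Let int1 : mu.-integrable B (fun s => ((1 + s)^-1)%:E).
Proof.
have [_ fin _] := gmu; apply/integrableP; split.
  by apply/measurable_EFinP; exact: (@stieltjes_kernel_measurable R 1 1 ltr01).
suff -> : (\int[mu]_(s in B) `|((1 + s)^-1)%:E| =
    \int[mu]_(s in B) ((1 + s)^-1)%:E)%E by [].
apply: eq_integral => s.
rewrite inE /B/= in_itv/= andbT => s0.
by rewrite /= ger0_norm// invr_ge0 addr_ge0// ltW.
Qed.

(** The absolute value keeps the majorant nonnegative at every real [s], also outside [(0, oo)], for
    [u > 0]. *)
Let dom (u : R) (n : nat) s := u ^- n * (1 + u^-1) * `|(1 + s)^-1|.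

Let int_dom u n : mu.-integrable B (EFin \o dom u n).
Proof.
have -> : EFin \o dom u n =
    (fun s => (u ^- n * (1 + u^-1))%:E * `|((1 + s)^-1)%:E|)%E.
  by apply/funext => s; rewrite /= -EFinM.
by apply: integrableZl => //; exact: integrable_abse.
Qed.

Let kernel_le_dom u z s n : 0 < u -> u <= z -> B s ->
  `|(z + s) ^- n.+1| <= dom u n s.
Proof.
move=> u0 uz; rewrite /B/= in_itv/= andbT => s0.
have /andP[k0 kle] := stieltjes_kernel_le n u0 uz s0.
rewrite (ger0_norm k0) (le_trans kle)// ler_wpM2l ?ler_norm//.
by rewrite mulr_ge0 ?invr_ge0 ?exprn_ge0 ?addr_ge0 ?invr_ge0 ?(ltW u0).
Qed.

Lemma stieltjes_kernel_integrable (z : R) n : 0 < z ->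
  mu.-integrable B (fun s => ((z + s) ^- n.+1)%:E).
Proof.
move=> z0; apply: le_integrable (int_dom z n) => //.
  by apply/measurable_EFinP; exact: stieltjes_kernel_measurable.
by move=> s Bs /=; rewrite lee_fin (le_trans (kernel_le_dom n z0 (lexx z) Bs))// ler_norm.
Qed.

(** This is [- g' z], as differentiation under the integral shows. *)
Definition stieltjes_d (z : R) : R := \int[mu]_(s in B) (z + s) ^- 2.

(** This neighbourhood of [z] stays above [z / 2], so the single majorant [dom (z / 2) 1] serves on
    all of it. *)
Let near_itv (z : R) : 0 < z -> (`]z / 2, z + 1[ : set R)%classic z.
Proof. by move=> z0 /=; rewrite in_itv/= ltr_pdivrMr// ltr_pMr// ltr1n ltrDl ltr01. Qed.

Lemma stieltjes_d_continuous (z : R) : 0 < z -> {for z, continuous stieltjes_d}.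
Proof.
move=> z0; have u0 : 0 < z / 2 by rewrite divr_gt0.
have xI x : (`]z / 2, z + 1[ : set R)%classic x -> z / 2 <= x.
  by rewrite /= in_itv/= => /andP[/ltW].
apply: (@continuity_under_integral R _ (measurableTypeR R) mu
  (fun x s => (x + s) ^- 2) B mB (z / 2) (z + 1) _ _ (dom (z / 2) 1)) => //.
- move=> x /xI zx; apply: stieltjes_kernel_integrable; exact: lt_le_trans zx.
- apply: aeW => s; rewrite /B/= in_itv/= andbT => s0 x; rewrite inE => /xI zx.
  have xs0 : x + s != 0 by rewrite gt_eqF// addr_gt0// (lt_le_trans u0).
  apply: (@continuous_comp _ _ _ (fun x : R => (x + s) ^+ 2) (fun y : R => y^-1)).
    apply: (@continuous_comp _ _ _ (fun x : R => x + s) (fun y : R => y ^+ 2)).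
      by apply: cvgD; [exact: cvg_id|exact: cvg_cst].
    exact: exprn_continuous.
  by apply: inv_continuous; rewrite expf_neq0.
- move=> x /xI zx; apply: aeW => s Bs; exact: kernel_le_dom.
- by rewrite inE; exact: near_itv.
Qed.

Lemma stieltjes_is_derive (z : R) : 0 < z -> is_derive z 1 g (- stieltjes_d z).
Proof.
move=> z0; have u0 : 0 < z / 2 by rewrite divr_gt0.
have xI x : (`]z / 2, z + 1[ : set R)%classic x -> z / 2 <= x.
  by rewrite /= in_itv/= => /andP[/ltW].
pose f (x s : R) := (x + s)^-1.
have dadd (x s : R) : is_derive x 1 (fun x : R => x + s) 1.
  by apply: is_derive_eq; rewrite addr0.
have addn0 x s : (`]z / 2, z + 1[ : set R)%classic x -> B s -> x + s != 0.
  move=> /xI zx; rewrite /B/= in_itv/= andbT => s0.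
  by rewrite gt_eqF// addr_gt0// (lt_le_trans u0).
have df x s : (`]z / 2, z + 1[ : set R)%classic x -> B s -> derivable (f ^~ s) x 1.
  move=> Ix Bs; apply: derivableV; first exact: addn0.
  by have [] := dadd x s.
have d1f x s : (`]z / 2, z + 1[ : set R)%classic x -> B s ->
    partial1of2 f x s = - (x + s) ^- 2.
  move=> Ix Bs; rewrite partial1of2E deriveV; last 2 first.
  - exact: addn0.
  - by have [] := dadd x s.
  by have [_ ->] := dadd x s; rewrite scaler1.
pose F x := \int[mu]_(s in B) f x s.
have intf x : (`]z / 2, z + 1[ : set R)%classic x -> mu.-integrable B (EFin \o f x).
  move=> /xI zx; apply: (@stieltjes_kernel_integrable x 0).
  exact: lt_le_trans zx.
have dom0 s : 0 <= dom (z / 2) 1 s.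
  by rewrite /dom mulr_ge0// mulr_ge0 ?invr_ge0 ?exprn_ge0 ?addr_ge0 ?invr_ge0 ?(ltW u0).
have d1f_ub x s : (`]z / 2, z + 1[ : set R)%classic x -> B s ->
    `|partial1of2 f x s| <= dom (z / 2) 1 s.
  move=> Ix Bs; rewrite d1f// normrN; apply: kernel_le_dom => //.
  exact: xI.
have dF := @derivable_under_integral R _ (measurableTypeR R) mu f B mB z _ _
  (near_itv z0) intf df _ dom0 (int_dom (z / 2) 1) d1f_ub.
have DF := @differentiation_under_integral R _ (measurableTypeR R) mu f B mB z _ _
  (near_itv z0) intf df _ dom0 (int_dom (z / 2) 1) d1f_ub.
(* [g] is given by the integral on [(0, oo)] only, which suffices near [z]. *)
apply: (@near_eq_is_derive _ _ _ F).
  have [_ _ gE] := gmu; near=> x.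
  have x0 : 0 < x by near: x; exact: lt_nbhsr.
  by rewrite /F /Rintegral -(gE _ x0).
split; first exact: dF.
rewrite -derive1E DF /stieltjes_d -[RHS]mulN1r -RintegralZl//; last first.
  exact: stieltjes_kernel_integrable.
apply: eq_Rintegral => s; rewrite inE => Bs.
by rewrite mulN1r d1f//; exact: near_itv.
Unshelve. all: end_near. Qed.

(** The kernel is strictly positive on [(0, oo)], so a zero integral means that [(0, oo)] is
    [mu]-null. Since [g(0+)] is infinite, this excludes zeros of [g] (n = 1) and of [g'] (n = 2). *)
Lemma stieltjes_kernel_integral_eq0 (z : R) n : 0 < z ->
  (\int[mu]_(s in B) ((z + s) ^- n)%:E = 0)%E ->
  forall w : R, 0 < w -> g w = 0.
Proof.
move=> z0 I0 w w0; have [_ _ gE] := gmu.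
have mk : measurable_fun B (fun s : R => ((z + s) ^- n)%:E).
  by apply/measurable_EFinP; exact: stieltjes_kernel_measurable.
have : ae_eq mu B (fun s : R => ((z + s) ^- n)%:E) (cst 0%E).
  apply/ae_eq_integral_abs => //; rewrite -[RHS]I0; apply: eq_integral => s.
  rewrite inE /B/= in_itv/= andbT => s0.
  by rewrite ger0_norm// invr_ge0 exprn_ge0// addr_ge0 ?ltW.
move=> ae0; apply: EFin_inj; rewrite gE//.
rewrite (@ae_eq_integral _ _ _ mu B (cst 0%E)) ?integral0//.
  by apply/measurable_EFinP; exact: (@stieltjes_kernel_measurable R w 1).
apply: filterS ae0 => s h Bs; have := h Bs; move: Bs.
rewrite /B/= in_itv/= andbT => s0 [/eqP].
by rewrite invr_eq0 expf_eq0 gt_eqF ?andbF// addr_gt0.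
Qed.

Context (g0 : g z @[z --> 0^'+] --> +oo).

Let g_neq0 : exists2 w, 0 < w & g w != 0.
Proof.
near (0 : R)^'+ => w; exists w; first by near: w; exact: nbhs_right_gt.
suff : 0 < g w by move/gt_eqF ->.
by near: w; move/cvgryPgt : g0.
Unshelve. all: end_near. Qed.

Lemma stieltjes_gt0 (z : R) : 0 < z -> 0 < g z.
Proof.
move=> z0; have [_ _ gE] := gmu.
have [w w0 gw0] := g_neq0.
have k0 s : B s -> (0 <= ((z + s)^-1)%:E)%E.
  rewrite /B/= in_itv/= andbT => s0.
  by rewrite lee_fin invr_ge0// addr_ge0 ?ltW.
rewrite -lte_fin gE// lt0e integral_ge0 ?andbT//.
apply: contra_neqN gw0 => /eqP I0.
exact: (@stieltjes_kernel_integral_eq0 z 1).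
Qed.

Lemma stieltjes_d_gt0 (z : R) : 0 < z -> 0 < stieltjes_d z.
Proof.
move=> z0; have [w w0 gw0] := g_neq0.
have k0 s : B s -> (0 <= ((z + s) ^- 2)%:E)%E.
  rewrite /B/= in_itv/= andbT => s0.
  by rewrite lee_fin invr_ge0// exprn_ge0// addr_ge0 ?ltW.
have fin := integrable_fin_num mB (@stieltjes_kernel_integrable z 1 z0).
rewrite /stieltjes_d /Rintegral -lte_fin fineK// lt0e integral_ge0 ?andbT//.
apply: contra_neqN gw0 => /eqP I0.
exact: (@stieltjes_kernel_integral_eq0 z 2).
Qed.

End stieltjes.

(** Nonnegativity excludes [-oo], on which [fine] takes the value 0. *)
Lemma ge0_fine_le (R : realType) (x : \bar R) (r : R) :
  (0 <= x)%E -> (x <= r%:E)%E -> fine x <= r.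
Proof. by case: x. Qed.

(** * The function y: positivity, integrability, the bound on N_t and the domain of g(A) *)

Unset Implicit Arguments.
Theorem theorem4p6 (R : realType)
    (mu : {measure set (measurableTypeR R) -> \bar R}) (g : R -> R)
    (g_stieltjes : stieltjes_rep00 mu g)
    (g_0 : g z @[z --> 0^'+] --> +oo)
    (alpha : R) (alpha_01 : 0 < alpha < 1)
    (g_incr : {in `]0, 1[ &,
       {homo (fun tau => tau `^ alpha * g tau) : x y / x <= y}})
    (eps : R -> R) (eps_sv : slowly_varying (g 1) eps)
    (eps_loc : inv_loc_integrable (g 1) eps) :
  [/\ forall s : R, 1 < s -> 0 < yfun g eps s,
      L1 (yfun g eps),
      Nt (yfun g eps) =O_+oo (fun t => (g t^-1 * eps (g t^-1))^-1)
    & dom_gA g (yfun g eps) <->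
      (\int[lebesgue_measure]_(tau in `]g 1%R, +oo[) ((tau * eps tau)^-1)%:E
         < +oo)%E].

Proof.
case/andP: alpha_01 => al0 al1.
pose r := alpha^-1.
have r1 : 1 < r by rewrite /r invf_gt1.
have dg (z : R) : 0 < z -> is_derive z 1 g (- stieltjes_d mu z).
  exact: stieltjes_is_derive.
have d0 (z : R) : 0 < z -> 0 < stieltjes_d mu z by exact: (stieltjes_d_gt0 g_stieltjes).
have gp (z : R) : 0 < z -> 0 < g z by exact: (stieltjes_gt0 g_stieltjes).
pose h (s : R) := g s^-1.
(* The derivative of [h]: the minus signs of [g'] and of the derivative of [1 / s] cancel. *)
pose dh (s : R) := stieltjes_d mu s^-1 / s ^+ 2.
have h0 (s : R) : 0 < s -> 0 < h s by move=> s0; rewrite /h gp ?invr_gt0.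
have dh0 (s : R) : 0 < s -> 0 < dh s.
  by move=> s0; rewrite /dh divr_gt0 ?exprn_gt0 ?d0 ?invr_gt0.
have dinv (s : R) : 0 < s -> is_derive s 1 (fun x : R => x^-1) (- s ^- 2).
  move=> s0; have sn0 : s != 0 by rewrite gt_eqF.
  split; first exact: derivableV.
  by rewrite deriveV// derive_id scaler1.
have hdh (s : R) : 0 < s -> is_derive s 1 h (dh s).
  move=> s0; have -> : dh s = - stieltjes_d mu s^-1 * - s ^- 2 by rewrite mulrNN.
  by apply: (is_derive1_comp (dg _ _) (dinv _ s0)); rewrite invr_gt0.
have inv_cont (s : R) : 0 < s -> {for s, continuous (fun x : R => x^-1)}.
  by move=> s0; apply: inv_continuous; rewrite gt_eqF.
have cdh (s : R) : 0 < s -> {for s, continuous dh}.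
  move=> s0; apply: cvgM.
    apply: (@continuous_comp _ _ _ (fun x : R => x^-1) (stieltjes_d mu)).
      exact: inv_cont.
    by apply: (stieltjes_d_continuous g_stieltjes); rewrite invr_gt0.
  apply: (@continuous_comp _ _ _ (fun x : R => x ^+ 2) (fun y : R => y^-1)).
    exact: exprn_continuous.
  by apply: inv_cont; rewrite exprn_gt0.
have hoo : h s @[s --> +oo] --> +oo.
  exact: (cvg_comp _ _ (@cvg_invr_at_right0 R) g_0).
have hlt := is_derive_gt0_homo hdh dh0.
have h1 : h 1 = g 1 by rewrite /h invr1.
have g10 : 0 < g 1 by rewrite gp.
have hg1 (s : R) : 1 < s -> g 1 < h s by move=> s1; rewrite -h1 hlt.
pose F (x : R) := (x ^+ 2 * eps x)^-1.
have [_ meps eps0 _] := eps_sv.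
have mF : measurable_fun `]g 1, +oo[ F by exact: measurable_inv_sqr_mul eps_sv.
have F0 (x : R) : g 1 < x -> 0 < F x.
  by move=> gx; rewrite /F invr_gt0 mulr_gt0 ?exprn_gt0 ?eps0// (lt_trans g10).
have yE (s : R) : 0 < s -> yfun g eps s = F (h s) * dh s.
  move=> s0; rewrite /yfun /F derive1E.
  have si0 : 0 < s^-1 by rewrite invr_gt0.
  have [_ ->] := dg _ si0.
  by rewrite mulNr opprK /dh -/(h s); mul_ac.
have y0 (s : R) : 1 < s -> 0 < yfun g eps s.
  move=> s1; have s0 := lt_trans ltr01 s1.
  by rewrite yE// mulr_gt0 ?F0 ?hg1 ?dh0.
have mh : measurable_fun (`]1, +oo[%classic : set R) h.
  apply: open_continuous_measurable_fun; first exact: interval_open.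
  move=> s; rewrite inE/= in_itv/= andbT => s1.
  have [dfh _] := hdh s (lt_trans ltr01 s1).
  by apply: differentiable_continuous; exact/derivable1_diffP.
have mdh : measurable_fun (`]1, +oo[%classic : set R) dh.
  apply: open_continuous_measurable_fun; first exact: interval_open.
  move=> s; rewrite inE/= in_itv/= andbT => s1.
  exact/cdh/(lt_trans ltr01).
have mFh : measurable_fun (`]1, +oo[%classic : set R) (F \o h).
  apply: (@measurable_comp _ _ _ _ _ _ (`]g 1, +oo[%classic : set R)) => //.
  by move=> _ [s + <-]; rewrite /= !in_itv/= !andbT; exact: hg1.
have my : measurable_fun (`]1, +oo[%classic : set R) (yfun g eps).
  apply: (@eq_measurable_fun _ _ _ _ _ (fun s => F (h s) * dh s)).
    move=> s; rewrite inE/= in_itv/= andbT => s1.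
    by rewrite yE// (lt_trans ltr01).
  exact: measurable_funM.
(* Used with [b = 1] for integrability and with [b = t] for the second term of [Nt]. *)
have tail_y (b : R) : 1 <= b ->
    (\int[lebesgue_measure]_(s in `]b, +oo[) `|yfun g eps s|%:E =
     \int[lebesgue_measure]_(x in `]h b, +oo[) (F x)%:E)%E.
  move=> b1; have hb : h 1 <= h b.
    by move: b1; rewrite le_eqVlt => /predU1P[<-//|/(hlt _ _ ltr01)/ltW].
  rewrite (@ge0_change_of_variables _ 0 b h dh F)//.
  - apply: eq_integral => s; rewrite inE/= in_itv/= andbT => bs.
    have s1 := le_lt_trans b1 bs.
    by rewrite gtr0_norm ?y0// yE// (lt_trans ltr01).
  - exact: lt_le_trans b1.
  - apply: measurable_funS mF => // x /=; rewrite !in_itv/= !andbT.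
    by apply: le_lt_trans; rewrite -h1.
  - by move=> x hx; apply/ltW/F0; rewrite -h1; exact: le_lt_trans hx.
have L1y : L1 (yfun g eps).
  apply/integrableP; split; first exact/measurable_EFinP.
  rewrite [X in (X < _)%E](tail_y 1 (lexx 1)) h1.
  exact: integral_inv_sqr_mul_lty.
split => //.
- have [T1 [C1 [gT1 C10 tail]]] := karamata_tail eps_sv.
  have [T2 [C2 [gT2 C20 head]]] := karamata_head g10 eps_sv eps_loc r1.
  (* [C2] bounds the averaged term of [Nt] and [C1] its tail term. *)
  apply/eqO_exP; exists (C2 + C1); first exact: addr_gt0.
  near=> t.
  have t1 : 1 < t by near: t; apply: nbhs_pinfty_gt; rewrite num_real.
  have T1t : T1 <= h t by near: t; move/cvgryPge : hoo.
  have T2t : T2 <= h t by near: t; move/cvgryPge : hoo.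
  have t0 := lt_trans ltr01 t1.
  have ht0 := h0 _ t0; have epst : 0 < eps (h t) by rewrite eps0 ?hg1.
  pose Q := (h t * eps (h t))^-1.
  have Q0 : 0 < Q by rewrite invr_gt0 mulr_gt0.
  pose I1 := \int[lebesgue_measure]_(s in `]1, t[) (s * `|yfun g eps s|).
  pose I2 := \int[lebesgue_measure]_(s in `]t, +oo[) `|yfun g eps s|.
  have I1_0 : 0 <= I1.
    apply: Rintegral_ge0 => s; rewrite /= in_itv/= => /andP[s1 _].
    by rewrite mulr_ge0// ltW// (lt_trans ltr01).
  have I2_0 : 0 <= I2 by exact: Rintegral_ge0.
  rewrite -/(h t) -/Q /Nt -/I1 -/I2 (gtr0_norm Q0).
  rewrite ger0_norm ?addr_ge0 ?mulr_ge0 ?invr_ge0 ?(ltW t0)//.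
  rewrite mulrDl lerD//; last first.
    apply: ge0_fine_le; first exact: integral_ge0.
    by rewrite tail_y ?(ltW t1)// tail.
  rewrite ler_pdivrMl//; apply: ge0_fine_le.
    apply: integral_ge0 => s; rewrite /= in_itv/= => /andP[s1 _].
    by rewrite lee_fin mulr_ge0// ltW// (lt_trans ltr01).
  (* The first factor is the scale in [s <= t / h t ^ r * h s ^ r]; the second is the head estimate
     at [T = h t]. *)
  have -> : t * (C2 * Q) = t / h t `^ r * (C2 * (h t `^ r * Q)).
    have hr : h t `^ r != 0 by rewrite gt_eqF// powR_gt0.
    by rewrite -[LHS]mulr1 -[X in _ * X = _](mulVf hr); mul_ac.
  pose G (x : R) := x `^ r * F x.
  have mG : measurable_fun `]g 1, +oo[ G.
    by apply: measurable_funM => //; apply: measurable_funTS; exact: measurable_powR.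
  have G0 x : g 1 < x -> 0 <= G x.
    by move=> gx; rewrite /G mulr_ge0 ?powR_ge0// ltW// F0.
  have mGh : measurable_fun (`]1, +oo[%classic : set R) (fun s => G (h s) * dh s).
    apply: measurable_funM => //.
    apply: (@measurable_comp _ _ _ _ _ _ (`]g 1, +oo[%classic : set R)) => //.
    by move=> _ [s + <-]; rewrite /= !in_itv/= !andbT; exact: hg1.
  have sub1 b : [set` Interval (BRight 1) (BSide b t)] `<=` (`]1, +oo[%classic : set R).
    by move=> s; rewrite /= !in_itv/= andbT => /andP[].
  have Gh0 s : 1 < s -> 0 <= G (h s) * dh s.
    by move=> s1; rewrite mulr_ge0 ?G0 ?hg1// ltW// dh0// (lt_trans ltr01).
  apply: (@ge0_le_integral_scale _ (measurableTypeR R) R (@lebesgue_measure R) _ _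
    (fun s => G (h s) * dh s)) => //.
  + apply: measurable_funM => //; apply: measurableT_comp => //.
    exact: measurable_funS my.
  + exact: measurable_funS mGh.
  + by rewrite divr_ge0 ?powR_ge0// ltW.
  + by move=> s; rewrite /= in_itv/= => /andP[s1 _]; exact: Gh0.
  + move=> s; rewrite /= in_itv/= => /andP[s1 st]; have s0 := lt_trans ltr01 s1.
    rewrite mulr_ge0 ?(ltW s0)//= gtr0_norm ?y0// yE// /G.
    have Fdh0 : 0 <= F (h s) * dh s.
      by rewrite mulr_ge0// ltW ?dh0 ?F0 ?hg1.
    have -> : t / h t `^ r * (h s `^ r * F (h s) * dh s) =
        t * h s `^ r / h t `^ r * (F (h s) * dh s) by mul_ac.
    rewrite ler_wpM2r// ler_pdivlMr ?powR_gt0//.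
    have inv01 (x : R) : 1 < x -> x^-1 \in `]0, 1[%R.
      move=> x1; have x0 := lt_trans ltr01 x1.
      rewrite in_itv/= invr_gt0 x0. by rewrite invf_lt1.
    have ts : t^-1 <= s^-1 by rewrite lef_pV2 ?posrE// ltW.
    (* Raised to the power [r = 1 / alpha], the monotonicity between [1 / t] and [1 / s] reads
       [h t ^ r / t <= h s ^ r / s]. *)
    have := g_incr _ _ (inv01 _ t1) (inv01 _ s1) ts.
    have rE (x : R) : 0 < x -> (x^-1 `^ alpha * h x) `^ r = x^-1 * h x `^ r.
      move=> x0; rewrite powRM ?powR_ge0 ?(ltW (h0 _ x0))// -powRrM mulfV ?gt_eqF//.
      by rewrite powRr1// invr_ge0 ltW.
    move=> /(ge0_ler_powR (ltW (lt_trans ltr01 r1))).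
    rewrite !nnegrE !mulr_ge0 ?powR_ge0 ?(ltW (gp _ _)) ?invr_gt0// => /(_ isT isT).
    rewrite -!/(h _) !rE// ler_pdivlMl// mulrCA ler_pdivrMl//.
  (* The right endpoint is added to match the half-open intervals of the change of variables. *)
  + apply: (@le_trans _ _
      (\int[lebesgue_measure]_(s in `]1%R, t]) (G (h s) * dh s)%:E)%E).
      apply: ge0_subset_integral => //.
      * by apply/measurable_EFinP; exact: measurable_funS mGh.
      * by move=> s; rewrite /= in_itv/= => /andP[s1 _]; rewrite lee_fin Gh0.
      * by move=> s; rewrite /= !in_itv/= => /andP[-> /ltW].
    rewrite -(@ge0_change_of_variables_bnd _ 0 1 t h dh G) ?h1 ?(ltW t1)//.
    exact: head.
(* As [F2 x = x * F x], the integrand [g (1 / s) * y s] is [F2 (h s) * dh s], and the two integrals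
   are equal in the extended reals. *)
- pose F2 (x : R) := (x * eps x)^-1.
  have mF2 : measurable_fun `]g 1, +oo[ F2.
    apply: (@eq_measurable_fun _ _ _ _ _ (fun x : R => x * F x)).
      move=> x; rewrite inE/= in_itv/= andbT => gx.
      rewrite /F /F2 expr2 -mulrA invfM mulrA mulfV ?mul1r//.
      by rewrite gt_eqF// (lt_trans g10).
    by apply: measurable_funM.
  have E : (\int[lebesgue_measure]_(s in `]1%R, +oo[) (g s^-1 * `|yfun g eps s|)%:E =
     \int[lebesgue_measure]_(tau in `]g 1%R, +oo[) (F2 tau)%:E)%E.
    rewrite -h1 (@ge0_change_of_variables _ 0 1 h dh F2)//.
    * apply: eq_integral => s; rewrite inE/= in_itv/= andbT => s1.
      have s0 := lt_trans ltr01 s1.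
      rewrite gtr0_norm ?y0// yE// -/(h s) /F /F2 expr2 mulrA; congr (_ * _)%:E.
      by rewrite -[(h s * h s) * _]mulrA invfM mulrA mulfV ?mul1r ?gt_eqF ?h0.
    * by rewrite h1.
    * move=> x; rewrite h1 => gx; rewrite /F2 invr_ge0 mulr_ge0 ?(ltW (eps0 _ gx))//.
      by rewrite ltW// (lt_trans g10).
  by split => [[_]|fin]; [rewrite E|split => //; rewrite E].
Unshelve. all: end_near. Qed.
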